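(* Let $n\ge l\ge1$ and let $\lambda$ be a partition of length $l(\lambda)\le l$. Then the element $$\prod_{i=1}^{\lambda_1}\det X^i_{\lambda'_i}$$ of $\mathbb C[x^i_j]\otimes\Lambda(\xi^i_j)$ is annihilated by the operators $$\sum_{j=1}^l\xi^i_j\frac{\partial}{\partial x^i_j}\ (1\le i\le n),\qquad \sum_{j=1}^lx^i_j\frac{\partial}{\partial\xi^{i+1}_j}\ (1\le i\le n-1),\qquad \sum_{i=1}^n\xi^i_j\frac{\partial}{\partial\xi^i_{j+1}}+\sum_{i=1}^nx^i_j\frac{\partial}{\partial x^i_{j+1}}\ (1\le j\le l-1),$$ and hence is a $\mathrm{gl}(n|n)\times\mathrm{gl}(l)$ highest weight vector with respect to the Borel subalgebra $B_1\times B'$.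
   Context: $\mathbb C[x^i_j]\otimes\Lambda(\xi^i_j)$ is the superalgebra generated by even (commuting) variables $x^i_j$ and odd (anticommuting) variables $\xi^i_j$, $1\le i\le n$, $1\le j\le l$; it is identified with the skew-symmetric (super exterior) algebra $\Lambda^*(\mathbb C^{n|n}\otimes\mathbb C^l)$ via $\xi^i_j=e^i\otimes e_j$, $x^i_j=e^{n+i}\otimes e_j$, where $e^1,\dots,e^n$ (even), $e^{n+1},\dots,e^{2n}$ (odd) is the standard basis of $\mathbb C^{n|n}$ and $e_1,\dots,e_l$ that of $\mathbb C^l$. $\mathrm{gl}(n|n)$ acts by the operators $\sum_j\xi^i_j\frac{\partial}{\partial\xi^k_j}$, $\sum_jx^i_j\frac{\partial}{\partial\xi^k_j}$, $\sum_jx^i_j\frac{\partial}{\partial x^k_j}$, $\sum_j\xi^i_j\frac{\partial}{\partial x^k_j}$ ($1\le i,k\le n$), and $\mathrm{gl}(l)$ by $\sum_{i=1}^n\xi^i_j\frac{\partial}{\partial\xi^i_k}+\sum_{i=1}^nx^i_j\frac{\partial}{\partial x^i_k}$ ($1\le j,k\le l$). $B_1$ is the Borel subalgebra of $\mathrm{gl}(n|n)$ of matrices that are upper triangular for the ordered basis $e^1,e^{n+1},e^2,e^{n+2},\dots,e^n,e^{2n}$; its nilradical is generated by the first two families of operators in the claim. $B'$ is the upper triangular Borel subalgebra of $\mathrm{gl}(l)$, with nilradical generated by the third family. For $k\ge1$, $X^k$ is the $l\times l$ matrix whose $i$-th row is $(x^i_1,\dots,x^i_l)$ for $1\le i\le\min(k-1,l)$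 and $(\xi^k_1,\dots,\xi^k_l)$ for $k\le i\le l$ (so $X^k=(x^i_j)_{1\le i,j\le l}$ for $k\ge l+1$). $X^k_r$ is its upper left $r\times r$ submatrix. $\lambda'_i$ is the length of the $i$-th column of $\lambda$. The determinant of $A=(a^i_j)$ (row $i$, column $j$) is $\sum_{\sigma\in S_r}\mathrm{sgn}(\sigma)a^1_{\sigma_1}a^2_{\sigma_2}\cdots a^r_{\sigma_r}$, in this order of multiplication. *)

(* Defs.v *)
From HB Require Import structures.
From mathcomp Require Import all_boot all_order all_fingroup all_algebra.
From mathcomp Require Import reals complex.
From mathcomp Require Import mpoly.
From mathcomp Require Import ring.

Set Implicit Arguments.
Unset Strict Implicit.
Unset Printing Implicit Defensive.

Import GRing.Theory.
Local Open Scope ring_scope.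

(* The superalgebra K[x_0, .., x_(p-1)] (x) Lambda(xi_0, .., xi_(q-1)).       *)
(* An element is stored as its coordinates in the K[x]-basis                  *)
(*   xi_S := xi_(s_1) * .. * xi_(s_r),   S = {s_1 < .. < s_r}.                *)
Record superpoly (K : comNzRingType) (p q : nat) : Type :=
  Superpoly { spcoef : {ffun {set 'I_q} -> {mpoly K[p]}} }.

(* The number of pairs (s, t) in S x T with t < s, so that                    *)
(* xi_S * xi_T = (-1) ^+ inversions S T *: xi_(S :|: T) for disjoint S, T.    *)
Definition inversions (q : nat) (S T : {set 'I_q}) : nat :=
  (\sum_(s in S) \sum_(t in T) (t < s))%N.

HB.instance Definition _ (K : comNzRingType) p q :=
  [isNew for @spcoef K p q].
HB.instance Definition _ (K : comNzRingType) p q :=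
  [Choice of superpoly K p q by <:].

Section SuperpolyRing.
Variables (K : comNzRingType) (p q : nat).
Local Notation A := (superpoly K p q).
Implicit Types (f g h : A) (S T U W : {set 'I_q}).

Definition spzero : A := Superpoly [ffun => 0].
Definition spopp f : A := Superpoly [ffun S => - spcoef f S].
Definition spadd f g : A := Superpoly [ffun S => spcoef f S + spcoef g S].
Definition spscale (c : K) f : A := Superpoly [ffun S => c *: spcoef f S].
Definition spone : A := Superpoly [ffun S : {set 'I_q} => (S == set0)%:R].
Definition spmul f g : A := Superpoly [ffun U : {set 'I_q} =>
  \sum_(S : {set 'I_q} | S \subset U)
     (-1) ^+ inversions S (U :\: S) * (spcoef f S * spcoef g (U :\: S))].

Lemma spP f g : (forall S, spcoef f S = spcoef g S) -> f = g.
Proof. by move=> e; apply/val_inj/ffunP. Qed.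

Fact spaddA : associative spadd.
Proof. by move=> f g h; apply: spP => S; rewrite !ffunE addrA. Qed.
Fact spaddC : commutative spadd.
Proof. by move=> f g; apply: spP => S; rewrite !ffunE addrC. Qed.
Fact spadd0 : left_id spzero spadd.
Proof. by move=> f; apply: spP => S; rewrite !ffunE add0r. Qed.
Fact spaddN : left_inverse spzero spopp spadd.
Proof. by move=> f; apply: spP => S; rewrite !ffunE addNr. Qed.
HB.instance Definition _ :=
  GRing.isZmodule.Build A spaddA spaddC spadd0 spaddN.

Lemma spcoef0 S : spcoef (0 : A) S = 0.
Proof. by rewrite ffunE. Qed.
Lemma spcoefD f g S : spcoef (f + g) S = spcoef f S + spcoef g S.
Proof. by rewrite ffunE. Qed.
Lemma spcoefN f S : spcoef (- f) S = - spcoef f S.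
Proof. by rewrite ffunE. Qed.

Fact spscaleA a b f : spscale a (spscale b f) = spscale (a * b) f.
Proof. by apply: spP => S; rewrite !ffunE scalerA. Qed.
Fact spscale1 : left_id 1 spscale.
Proof. by move=> f; apply: spP => S; rewrite !ffunE scale1r. Qed.
Fact spscaleDr : right_distributive spscale +%R.
Proof. by move=> c f g; apply: spP => S; rewrite !ffunE scalerDr. Qed.
Fact spscaleDl f : {morph spscale^~ f : a b / a + b}.
Proof. by move=> a b; apply: spP => S; rewrite !ffunE scalerDl. Qed.
HB.instance Definition _ := GRing.Zmodule_isLmodule.Build K A
  spscaleA spscale1 spscaleDr spscaleDl.

Lemma spcoefZ c f S : spcoef (c *: f) S = c *: spcoef f S.
Proof. by rewrite ffunE. Qed.

Lemma inversions0l T : inversions set0 T = 0%N.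
Proof. by rewrite /inversions big_set0. Qed.
Lemma inversions0r S : inversions S set0 = 0%N.
Proof. by rewrite /inversions big1 // => s _; rewrite big_set0. Qed.
Lemma inversionsDl S U T : S \subset U ->
  inversions U T = (inversions S T + inversions (U :\: S) T)%N.
Proof.
by move=> sSU; rewrite {1}/inversions (big_setID S) /= (setIidPr sSU).
Qed.
Lemma inversionsDr S T U : T \subset U ->
  inversions S U = (inversions S T + inversions S (U :\: T))%N.
Proof.
move=> sTU; rewrite /inversions -big_split /=; apply: eq_bigr => s _.
by rewrite (big_setID T) /= (setIidPr sTU).
Qed.

Fact spmulA : associative spmul.
Proof.
move=> f g h; apply: spP => W; rewrite !ffunE.
transitivity (\sum_(S : {set 'I_q} | S \subset W)
    \sum_(U : {set 'I_q} | (S \subset U) && (U \subset W))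
    (-1) ^+ (inversions S (U :\: S) + inversions U (W :\: U)) *
      (spcoef f S * spcoef g (U :\: S) * spcoef h (W :\: U))).
  apply: eq_bigr => S sSW; rewrite ffunE.
  rewrite (reindex_onto (fun U => U :\: S) (fun T => T :|: S)) /=; last first.
    move=> T; rewrite subsetD => /andP[_ /setDidPl dTS].
    by rewrite setDUl setDv setU0 dTS.
  rewrite !mulr_sumr; apply: eq_big => [U|U].
    apply/andP/andP => [[]|[sSU sUW]].
      rewrite subsetD => /andP[sUSW _] /eqP eU; split.
        by rewrite -eU subsetUr.
      by rewrite -eU subUset sUSW.
    split; first by rewrite setSD.
    by rewrite -{2}(setID U S) (setIidPr sSU) setUC.
  case/andP=> sUS /eqP eU.
  have sSU : S \subset U by rewrite -eU subsetUr.
  have sUW : U \subset W.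
    by rewrite -eU subUset sSW andbT (subset_trans sUS) ?subsetDl.
  have eDD : (W :\: S) :\: (U :\: S) = W :\: U.
    by rewrite setDDl -{1}(setIidPr sSU) setID.
  rewrite eDD (inversionsDr S sUS) eDD (inversionsDl (W :\: U) sSU) !exprD.
  by rewrite -!mulrA; congr (_ * (_ * _)); rewrite mulrCA.
rewrite (exchange_big_dep (fun U : {set 'I_q} => U \subset W)) /=; last first.
  by move=> S U _ /andP[].
apply: eq_bigr => U sUW; rewrite ffunE mulr_suml mulr_sumr.
apply: eq_big => [S|S /andP[_ _]].
  rewrite sUW andbT; apply/andP/idP => [[]//|sSU].
  by rewrite sSU (subset_trans sSU).
by rewrite exprD !mulrA; congr (_ * _ * _ * _); rewrite mulrC.
Qed.

Fact spmul1 : left_id spone spmul.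
Proof.
move=> f; apply: spP => U; rewrite !ffunE (bigD1 set0) ?sub0set //=.
rewrite ffunE eqxx inversions0l setD0 !mul1r big1 ?addr0 // => S.
by case/andP=> _ /negPf nS; rewrite ffunE nS mul0r mulr0.
Qed.
Fact spmulr1 : right_id spone spmul.
Proof.
move=> f; apply: spP => U; rewrite !ffunE (bigD1 U) //=.
rewrite ffunE setDv eqxx inversions0r mulr1 mul1r big1 ?addr0 // => S.
case/andP=> sSU nS; rewrite ffunE setD_eq0 mulrC.
by rewrite eqEsubset sSU /= in nS; rewrite (negPf nS) !mulr0 mul0r.
Qed.
Fact spmulDl : left_distributive spmul +%R.
Proof.
move=> f g h; apply: spP => U; rewrite !ffunE -big_split /=.
by apply: eq_bigr => S _; rewrite ffunE mulrDl mulrDr.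
Qed.
Fact spmulDr : right_distributive spmul +%R.
Proof.
move=> f g h; apply: spP => U; rewrite !ffunE -big_split /=.
by apply: eq_bigr => S _; rewrite ffunE !mulrDr.
Qed.
Fact spone_neq0 : spone != 0.
Proof.
apply/eqP => /(congr1 (fun f => spcoef f set0)) /eqP.
by rewrite !ffunE eqxx oner_eq0.
Qed.
HB.instance Definition _ := GRing.Zmodule_isNzRing.Build A
  spmulA spmul1 spmulr1 spmulDl spmulDr spone_neq0.

Lemma spcoef1 S : spcoef (1 : A) S = (S == set0)%:R.
Proof. by rewrite ffunE. Qed.
Lemma spcoefM f g U : spcoef (f * g) U =
  \sum_(S : {set 'I_q} | S \subset U)
     (-1) ^+ inversions S (U :\: S) * (spcoef f S * spcoef g (U :\: S)).
Proof. by rewrite ffunE. Qed.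

Fact spscaleAl (c : K) f g : c *: (f * g) = c *: f * g.
Proof.
apply: spP => U; rewrite spcoefZ !spcoefM scaler_sumr.
by apply: eq_bigr => S _; rewrite spcoefZ -!scalerAl scalerAr.
Qed.
Fact spscaleAr (c : K) f g : c *: (f * g) = f * (c *: g).
Proof.
apply: spP => U; rewrite spcoefZ !spcoefM scaler_sumr.
by apply: eq_bigr => S _; rewrite spcoefZ -!scalerAr.
Qed.
HB.instance Definition _ := GRing.Lmodule_isLalgebra.Build K A spscaleAl.
HB.instance Definition _ := GRing.Lalgebra_isAlgebra.Build K A spscaleAr.

Definition spX (a : 'I_p) : A :=
  Superpoly [ffun S : {set 'I_q} => if S == set0 then 'X_a else 0].
Definition spXi (a : 'I_q) : A := Superpoly [ffun S : {set 'I_q} => (S == [set a])%:R].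

Definition spdX (a : 'I_p) f : A := Superpoly [ffun S => (spcoef f S)^`M(a)].

(* The left derivative: xi_a * xi_S |-> xi_S and xi_S |-> 0 if a \notin S.    *)
Definition spdXi (a : 'I_q) f : A := Superpoly [ffun S : {set 'I_q} =>
  if a \in S then 0
  else (-1) ^+ inversions [set a] S * spcoef f (a |: S)].

Definition spparity f : A :=
  Superpoly [ffun S : {set 'I_q} => (-1) ^+ #|S| * spcoef f S].

Lemma spcoef_mulX a f S : spcoef (spX a * f) S = 'X_a * spcoef f S.
Proof.
rewrite spcoefM (bigD1 set0) ?sub0set //= inversions0l setD0 mul1r ffunE eqxx.
by rewrite big1 ?addr0 // => T /andP[_ /negPf nT]; rewrite ffunE nT mul0r mulr0.
Qed.
Lemma spX_comm a f : spX a * f = f * spX a.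
Proof.
apply: spP => S; rewrite spcoef_mulX spcoefM (bigD1 S) //= setDv inversions0r.
rewrite ffunE eqxx mul1r mulrC big1 ?addr0 // => T /andP[sTS nT].
rewrite ffunE setD_eq0; rewrite eqEsubset sTS /= in nT.
by rewrite (negPf nT) !mulr0.
Qed.

Lemma spcoef_mulXi a f S : spcoef (spXi a * f) S =
  if a \in S then (-1) ^+ inversions [set a] (S :\ a) * spcoef f (S :\ a) else 0.
Proof.
rewrite spcoefM; case: ifPn => aS.
  rewrite (bigD1 [set a]) ?sub1set //= ffunE eqxx mul1r big1 ?addr0 // => T.
  by case/andP=> _ /negPf nT; rewrite ffunE nT mul0r mulr0.
rewrite big1 // => T sTS; rewrite ffunE; case: eqP => [eT|]; last first.
  by rewrite mul0r mulr0.
by move: sTS; rewrite eT sub1set (negPf aS).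
Qed.

Lemma inversions11 (a b : 'I_q) : inversions [set a] [set b] = (b < a)%N.
Proof. by rewrite /inversions !big_set1. Qed.

Lemma spXi_anticomm a b : spXi a * spXi b = - (spXi b * spXi a).
Proof.
apply: spP => S; rewrite spcoefN !spcoef_mulXi !ffunE.
case: (altP (a =P b)) => [<-|nab].
  have -> : (S :\ a == [set a]) = false.
    by apply/eqP => /setP/(_ a); rewrite !inE eqxx.
  by rewrite mulr0; case: ifP; rewrite oppr0.
have E c d : c != d -> (c \in S) && (S :\ c == [set d]) = (S == [set c; d]).
  move=> ncd; apply/andP/eqP => [[cS /eqP e]|->].
    by rewrite -(setD1K cS) e.
  rewrite !inE eqxx; split=> //; apply/eqP/setP=> x; rewrite !inE.
  by have [->|] := eqVneq x c; rewrite ?(negPf ncd).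
have:= E a b nab; have:= E b a; rewrite eq_sym nab setUC => /(_ isT).
case: (S =P _) => [->|_ e1 e2].
  case/andP=> -> /eqP -> /andP[-> /eqP ->]; rewrite !eqxx !mulr1 !inversions11.
  by case: ltngtP nab => [_ _|_ _|/val_inj-> /eqP//]; rewrite ?opprK.
case: (b \in S) e1 => /= [->|_]; case: (a \in S) e2 => /= [->|_];
  by rewrite ?mulr0 ?oppr0.
Qed.
Lemma spXi_sq0 a : spXi a * spXi a = 0.
Proof.
apply: spP => S; rewrite spcoef_mulXi !ffunE.
have -> : (S :\ a == [set a]) = false.
  by apply/eqP => /setP/(_ a); rewrite !inE eqxx.
by rewrite mulr0 if_same.
Qed.

Fact spdX_linear a : linear (spdX a).
Proof.
by move=> c f g; apply: spP => S; rewrite !ffunE mderivD mderivZ.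
Qed.
HB.instance Definition _ a :=
  GRing.isLinear.Build K A A *:%R (spdX a) (spdX_linear a).
Fact spdXi_linear a : linear (spdXi a).
Proof.
move=> c f g; apply: spP => S; rewrite !ffunE; case: ifP => _.
  by rewrite scaler0 addr0.
by rewrite mulrDr scalerAr.
Qed.
HB.instance Definition _ a :=
  GRing.isLinear.Build K A A *:%R (spdXi a) (spdXi_linear a).

Lemma spdX_X a b : spdX a (spX b) = (a == b)%:R.
Proof.
apply: spP => S; rewrite !ffunE; case: (S == set0) / eqP => eS; last first.
  rewrite mderiv0; case: (a == b); rewrite ?spcoef0 // spcoef1.
  by case: eqP eS.
rewrite mderivX mnm1E eq_sym; case: eqP => [->|_]; last first.
  by rewrite scale0r spcoef0.
have -> : (U_(b) - U_(b) = 0 :> 'X_{1..p})%MM.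
  by apply/mnmP=> i; rewrite mnmBE subnn mnm0E.
by rewrite scale1r mpolyX0 spcoef1 eS eqxx.
Qed.
Lemma spdX_Xi a b : spdX a (spXi b) = 0.
Proof.
by apply: spP => S; rewrite !ffunE -mpolyC_nat mderivC.
Qed.
Lemma spdXi_X a b : spdXi a (spX b) = 0.
Proof.
apply: spP => S; rewrite !ffunE; case: ifP => // _.
by rewrite setU_eq0 -cards_eq0 cards1 mulr0.
Qed.
Lemma spdXi_Xi a b : spdXi a (spXi b) = (a == b)%:R.
Proof.
apply: spP => S; rewrite !ffunE.
case: ifPn => aS.
  case: eqP => _; rewrite ?spcoef0 // spcoef1; case: eqP => // eS.
  by rewrite eS inE in aS.
case: (eqVneq S set0) => [->|nS].
  rewrite inversions0r setU0 mul1r (inj_eq set1_inj).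
  by case: eqP; rewrite ?spcoef0 ?spcoef1 ?eqxx.
have -> : (a |: S == [set b]) = false.
  apply/eqP => e; case/set0Pn: nS => c cS.
  have: a \in [set b] by rewrite -e setU11.
  have: c \in [set b] by rewrite -e setU1r.
  by rewrite !inE => /eqP ec /eqP ea; move: aS; rewrite ea -ec cS.
by rewrite mulr0; case: eqP; rewrite ?spcoef0 // spcoef1 (negPf nS).
Qed.

Lemma spdX_Leibniz a f g : spdX a (f * g) = spdX a f * g + f * spdX a g.
Proof.
apply: spP => U; rewrite spcoefD !spcoefM ffunE spcoefM raddf_sum -big_split.
apply: eq_bigr => S _ /=; rewrite !ffunE.
rewrite -signr_odd !mulr_sign; case: (odd _); rewrite ?mderivN mderivM //.
by rewrite opprD.
Qed.

Lemma inversions1_add a S : a \notin S ->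
  (inversions [set a] S + inversions S [set a] = #|S|)%N.
Proof.
move=> aS; rewrite /inversions big_set1 -big_split -sum1_card /=.
apply: eq_bigr => s sS; rewrite big_set1.
by case: ltngtP => // /val_inj e; rewrite -e sS in aS.
Qed.
Lemma inversionsU1l a S T : a \notin S ->
  inversions (a |: S) T = (inversions [set a] T + inversions S T)%N.
Proof. by move=> aS; rewrite (@inversionsDl [set a]) ?subsetUl // setU1K. Qed.
Lemma inversionsU1r a S T : a \notin T ->
  inversions S (a |: T) = (inversions S [set a] + inversions S T)%N.
Proof. by move=> aT; rewrite (@inversionsDr _ [set a]) ?subsetUl // setU1K. Qed.

Lemma sum_subsetU1 (V : zmodType) a U (F : {set 'I_q} -> V) : a \notin U ->
  \sum_(S : {set 'I_q} | S \subset a |: U) F S =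
  \sum_(S : {set 'I_q} | S \subset U) (F (a |: S) + F S).
Proof.
move=> aU; rewrite big_split (bigID (fun S : {set 'I_q} => a \in S)) /=.
congr (_ + _); last first.
  apply: eq_bigl => S; apply/andP/idP => [[sS aS]|sS].
    by rewrite -(setU1K aU) subsetD1 sS.
  split; first by rewrite (subset_trans sS) ?subsetUr.
  by apply: contra aU; apply: (subsetP sS).
rewrite (reindex_onto (fun S => a |: S) (fun S => S :\ a)) /=; last first.
  by move=> S /andP[_ aS]; rewrite setD1K.
apply: eq_bigl => S; rewrite setU11 andbT.
apply/andP/idP => [[sS /eqP e]|sS].
  by rewrite -e -(setU1K aU) setSD.
split; first by rewrite setUS.
by rewrite setU1K //; apply: contra aU; apply: (subsetP sS).
Qed.

Lemma spdXi_Leibniz a f g :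
  spdXi a (f * g) = spdXi a f * g + spparity f * spdXi a g.
Proof.
have sgnK m : (-1) ^+ m * (-1) ^+ m = 1 :> {mpoly K[p]}.
  by rewrite -exprD -signr_odd oddD addbb.
apply: spP => U; rewrite spcoefD !spcoefM ffunE; case: ifPn => aU.
  rewrite -big_split /= -(setD1K aU); move: (U :\ a) (setD11 a U) => V /negbT aV.
  rewrite sum_subsetU1 // big1 // => S sSV; rewrite !ffunE.
  have aS : a \notin S by apply: contra aV; apply: (subsetP sSV).
  have aVS : a \notin V :\: S by rewrite inE negb_and aV orbT.
  have -> : (a |: V) :\: (a |: S) = V :\: S.
    by rewrite -setDDl setU1K.
  have -> : (a |: V) :\: S = a |: (V :\: S).
    apply/setP=> x; rewrite !inE; case: eqP => // ->; by rewrite aS.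
  rewrite !setU11 (negPf aS) (negPf aVS) cardsU1 aS !(mul0r, mulr0).
  rewrite add0r addr0 inversionsU1l // inversionsU1r // -(inversions1_add aS).
  rewrite !exprD expr1.
  have uu := sgnK (inversions [set a] (V :\: S)).
  by ring: uu.
rewrite spcoefM sum_subsetU1 // mulr_sumr -big_split /=.
apply: eq_bigr => S sSU; rewrite !ffunE.
have aS : a \notin S by apply: contra aU; apply: (subsetP sSU).
have aUS : a \notin U :\: S by rewrite inE negb_and aU orbT.
have -> : (a |: U) :\: (a |: S) = U :\: S.
  by rewrite -setDDl setU1K.
have -> : (a |: U) :\: S = a |: (U :\: S).
  apply/setP=> x; rewrite !inE; case: eqP => // ->; by rewrite aS.
rewrite (negPf aS) (negPf aUS) inversionsU1l // inversionsU1r //.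
rewrite (@inversionsDr [set a] S U) // -(inversions1_add aS).
rewrite !exprD.
have uu := sgnK (inversions [set a] (U :\: S)).
by ring: uu.
Qed.
End SuperpolyRing.

Section Operators.
Variables (K : comNzRingType) (n l : nat).

(* K[x^i_j] (x) Lambda(xi^i_j), 1 <= i <= n, 1 <= j <= l.  All indices i, j   *)
(* are shifted to start at 0.                                                 *)
Definition xxi_alg := superpoly K (n * l) (n * l).

Definition xvar (i : 'I_n) (j : 'I_l) : xxi_alg := spX K _ (mxvec_index i j).
Definition xivar (i : 'I_n) (j : 'I_l) : xxi_alg := spXi K _ (mxvec_index i j).
Definition dx (i : 'I_n) (j : 'I_l) (f : xxi_alg) : xxi_alg :=
  spdX (mxvec_index i j) f.
Definition dxi (i : 'I_n) (j : 'I_l) (f : xxi_alg) : xxi_alg :=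
  spdXi (mxvec_index i j) f.

(* The standard basis e^1, .., e^n | e^(n+1), .., e^(2n) of K^(n|n) is        *)
(* indexed by 'I_(n + n), and gen a j stands for e^a (x) e_j.                 *)
Definition gen (a : 'I_(n + n)) (j : 'I_l) : xxi_alg :=
  match split a with inl i => xivar i j | inr i => xvar i j end.
Definition dgen (a : 'I_(n + n)) (j : 'I_l) (f : xxi_alg) : xxi_alg :=
  match split a with inl i => dxi i j f | inr i => dx i j f end.

Definition glnn_act (M : 'M[K]_(n + n)) (f : xxi_alg) : xxi_alg :=
  \sum_a \sum_b M a b *: \sum_(j < l) gen a j * dgen b j f.

Definition gll_act (P : 'M[K]_l) (f : xxi_alg) : xxi_alg :=
  \sum_j \sum_k P j k *:
    (\sum_(i < n) xivar i j * dxi i k f + \sum_(i < n) xvar i j * dx i k f).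

Definition gl_act (M : 'M[K]_(n + n)) (P : 'M[K]_l) (f : xxi_alg) : xxi_alg :=
  glnn_act M f + gll_act P f.

(* Position in the ordered basis e^1, e^(n+1), e^2, e^(n+2), .., e^n, e^(2n). *)
Definition interleaved (a : 'I_(n + n)) : nat :=
  match split a with inl i => i.*2 | inr i => i.*2.+1 end.

(* Upper triangular with respect to the basis ordered by pos.                 *)
Definition upper_triangular m (pos : 'I_m -> nat) (M : 'M[K]_m) : Prop :=
  forall a b, (pos b < pos a)%N -> M a b = 0.

Definition borel1 : 'M[K]_(n + n) -> Prop := upper_triangular interleaved.
Definition borel' : 'M[K]_l -> Prop := upper_triangular (@nat_of_ord l).

(* The nilradical of such a Borel subalgebra is its part with zero diagonal,  *)
(* and the Cartan subalgebra consists of the diagonal matrices.               *)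
Definition nilradical m (borel : 'M[K]_m -> Prop) (M : 'M[K]_m) : Prop :=
  borel M /\ forall a, M a a = 0.

Definition highest_weight_vector (v : xxi_alg) : Prop :=
  [/\ v != 0,
      forall M P, nilradical borel1 M -> nilradical borel' P -> gl_act M P v = 0
    & exists (wt : 'rV[K]_(n + n)) (wt' : 'rV[K]_l),
      forall (h : 'rV[K]_(n + n)) (h' : 'rV[K]_l),
        gl_act (diag_mx h) (diag_mx h') v =
          (\sum_a h 0 a * wt 0 a + \sum_j h' 0 j * wt' 0 j) *: v].

Definition ord_min (m : nat) (i : 'I_l) : 'I_l :=
  Ordinal (leq_ltn_trans (geq_minr m i) (ltn_ord i)).

(* X^k for k >= 1.  The row of 0-based index i is x^i if i < k - 1, and       *)
(* xi^(k - 1) otherwise; in the latter case k - 1 = min(k - 1, i) < l <= n.   *)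
Definition Xmx (le_ln : (l <= n)%N) (k : nat) : 'M[xxi_alg]_l :=
  \matrix_(i < l, j < l)
    if (i < k.-1)%N then xvar (widen_ord le_ln i) j
    else xivar (widen_ord le_ln (ord_min k.-1 i)) j.

End Operators.

Definition upper_left (T : Type) (r l : nat) (le_rl : (r <= l)%N)
    (M : 'M[T]_l) : 'M[T]_r :=
  mxsub (widen_ord le_rl) (widen_ord le_rl) M.

Definition is_partition (lam : seq nat) : bool :=
  sorted geq lam && (0%N \notin lam).

(* The length of the k-th column of lam, for k >= 1.                          *)
Definition column_length (lam : seq nat) (k : nat) : nat :=
  count (fun part => k <= part)%N lam.

Lemma column_length_leq (lam : seq nat) (l : nat) (lam_len : (size lam <= l)%N)
  (k : nat) : (column_length lam k <= l)%N.
Proof. exact: leq_trans (count_size _ _) lam_len. Qed.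

(* Main.v *)
Require Import Defs.
From HB Require Import structures.
From mathcomp Require Import all_boot all_order all_fingroup all_algebra.
From mathcomp Require Import reals complex.
From mathcomp Require Import mpoly.
From mathcomp Require Import ring.

Set Implicit Arguments.
Unset Strict Implicit.
Unset Printing Implicit Defensive.

Import GRing.Theory Num.Theory.
Local Open Scope ring_scope.

(** Write D_k for the k-th determinant, r_k for its size, and number rows and
columns from 0: the rows of D_k are x^p for p < k - 1 and xi^(k-1) for
p >= k - 1, all cut to the columns below r_k.

Every operator in play is a superderivation, of the form
E_(a b) = sum_j e^a_j d/de^b_j (replace the letter b by the letter a) or
C_(j m) = sum_a e^a_j d/de^a_m (replace the column m by the column j).  So
almost everything can be tested on one factor D_k:
- C_(j m) with j < m kills D_k, because it produces two equal columns or
  because the column m is absent;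
- an operator replacing some letter by the row x^i kills D_k as soon as x^i
  already is another row: two equal rows with central entries.  This settles
  x^i d/dxi^(i+1), and also x^p d/dx^i for p < i;
- the diagonal operators act on D_k by integers.

The operator E = sum_j xi^i_j d/dx^i_j is different: it kills D_k for
k <= i + 1 but not the later factors.  What vanishes is the product of D_(i+1)
with E applied to the later factors w.  Put D = D_(i+1), and let N be the
number of rows xi^i of D.  Since D has only odd rows xi^i, expanding
sum_m xi^i_m C_(j m) D = xi^i_j D in two ways gives, for every column j of D,
    (N + 1) xi^i_j D = sum_p x^p_j (E_(xi^i x^p) D),
where only p < i contributes (xi_mul_gen_det).  Hence, up to a sign,
    (N + 1) D E(w) = sum_(p < i) (E_(xi^i x^p) D) (sum_j x^p_j d/dx^i_j w),
and the last factor vanishes by the equal rows argument; here one uses that w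
involves no column beyond those of D, as the columns of a partition decrease.
This is glnn_op_xi_x_prod.

The other root vectors of the nilradical are supercommutators of the simple
ones.  For non-vanishing, specialize (x^i_j) to the identity: D_k becomes a
positive multiple of the product of the xi^(k-1)_p for k - 1 <= p < r_k, and
these monomials involve different odd variables for different k. *)

(** * Determinants over a noncommutative ring *)

Section Products.
Variable A : pzRingType.

Lemma prod_extract_central (r : nat) (a : 'I_r -> A) (p : 'I_r) :
    (forall f, a p * f = f * a p) ->
  \prod_q a q = a p * \prod_q (if q == p then 1 else a q).
Proof.
move=> ap; have: p \in index_enum 'I_r by rewrite mem_index_enum.
have: uniq (index_enum 'I_r) by rewrite index_enum_uniq.
elim: (index_enum _) => // q s IHs /= /andP[qs us]; rewrite inE => /predU1P[eqp|ps].
  rewrite -eqp !big_cons eqxx mul1r; congr (_ * _).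
  by apply: eq_big_seq => q' q's; case: eqP q's => // ->; rewrite eqp (negPf qs).
rewrite !big_cons IHs //; case: eqP ps qs => [<- -> //|_ _ _].
by rewrite !mulrA ap.
Qed.

Lemma prod_eq0 (r : nat) (a : 'I_r -> A) (p : 'I_r) :
  a p = 0 -> \prod_q a q = 0.
Proof.
move=> ap; rewrite (@prod_extract_central _ _ p) ap ?mul0r // => f.
by rewrite mulr0 mul0r.
Qed.

(** The terms cancel in pairs s, h s; h is meant to be composition with a
transposition, on one side or the other. *)
Lemma sum_signed_perm_eq0 (r : nat) (h : 'S_r -> 'S_r) (F : 'S_r -> A) :
    injective h -> (forall s, odd_perm (h s) = ~~ odd_perm s) ->
    (forall s, F (h s) = F s) ->
  \sum_(s : 'S_r) (-1) ^+ s * F s = 0.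
Proof.
move=> hI ho hF; rewrite (bigID (@odd_perm _)) /= (reindex_inj hI) /=.
rewrite (eq_bigl (fun s => ~~ odd_perm s)) => [|s]; last by rewrite ho.
rewrite -big_split big1 //= => s nos; rewrite ho hF (negPf nos).
by rewrite mulN1r mul1r addNr.
Qed.

(** The terms of s and of s composed with the transposition of c and c' are the
same products in the same order, with opposite signs. *)
Lemma det_equal_columns (r : nat) (M : 'M[A]_r) (c c' : 'I_r) :
  c != c' -> (forall p, M p c = M p c') -> \det M = 0.
Proof.
move=> ncc eM; apply: (@sum_signed_perm_eq0 _ (fun s => s * tperm c c')%g).
- exact: mulIg.
- by move=> s; rewrite odd_permM odd_tperm ncc addbT.
- by move=> s; apply: eq_bigr => p _; rewrite permM; case: tpermP => [->|->|].
Qed.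

(** Transposing p and p' in s now exchanges two factors of the product; they
can be moved past the others because they are central. *)
Lemma det_equal_central_rows (r : nat) (M : 'M[A]_r) (p p' : 'I_r) :
    p != p' -> (forall c, M p c = M p' c) ->
    (forall c f, M p c * f = f * M p c) ->
  \det M = 0.
Proof.
move=> npp eM cM; apply: (@sum_signed_perm_eq0 _ (fun s => tperm p p' * s)%g).
- exact: mulgI.
- by move=> s; rewrite odd_permM odd_tperm npp addTb.
move=> s.
have E (s' : 'S_r) : \prod_q M q (s' q) = M p (s' p) * (M p (s' p') *
    \prod_q (if q == p' then 1 else if q == p then 1 else M q (s' q))).
  rewrite (@prod_extract_central _ _ p) //; congr (_ * _).
  rewrite (@prod_extract_central _ _ p') eq_sym (negPf npp) ?eM //.
  by move=> f; rewrite -eM.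
rewrite !E !permM tpermL tpermR mulrA cM -mulrA; congr (_ * (_ * _)).
apply: eq_bigr => q _; rewrite permM.
by case: eqP => // /eqP; case: eqP => // /eqP; case: tpermP => // ->; rewrite eqxx.
Qed.
End Products.

(** * Parity and superderivations *)

Section Parity.
Variables (K : comNzRingType) (p q : nat).
Local Notation A := (superpoly K p q).
Implicit Types (f g : A) (S : {set 'I_q}).

Fact spparity_linear : linear (@spparity K p q).
Proof. by move=> c f g; apply: spP => S; rewrite !ffunE mulrDr scalerAr. Qed.
HB.instance Definition _ :=
  GRing.isLinear.Build K A A *:%R (@spparity K p q) spparity_linear.

Fact spparity_monoid_morphism : monoid_morphism (@spparity K p q).
Proof.
split=> [|f g]; apply: spP => U.
  rewrite !ffunE; case: eqP => [->|_]; first by rewrite cards0 mul1r.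
  by rewrite mulr0.
rewrite ffunE !spcoefM mulr_sumr; apply: eq_bigr => S sSU; rewrite !ffunE.
have -> : #|U| = (#|S| + #|U :\: S|)%N by rewrite -{1}(setIidPr sSU) cardsID.
by rewrite exprD; ring.
Qed.
HB.instance Definition _ :=
  GRing.isMonoidMorphism.Build A A (@spparity K p q) spparity_monoid_morphism.

Lemma spparity_X (a : 'I_p) : spparity (spX K q a) = spX K q a.
Proof.
apply: spP => S; rewrite !ffunE; case: eqP => [->|_]; last exact: mulr0.
by rewrite cards0 mul1r.
Qed.

Lemma spparity_Xi (a : 'I_q) : spparity (spXi K p a) = - spXi K p a.
Proof.
apply: spP => S; rewrite !ffunE; case: eqP => [->|_]; last by rewrite mulr0 oppr0.
by rewrite cards1 mulr1.
Qed.

(** Supercommutativity, without having to choose homogeneous elements: the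
parity automorphism carries the sign. *)
Lemma spXi_comm (a : 'I_q) f : spXi K p a * f = spparity f * spXi K p a.
Proof.
apply: spP => U; rewrite spcoef_mulXi spcoefM; case: ifPn => aU; last first.
  rewrite big1 // => S sSU; rewrite !ffunE; case: eqP => [e|]; last by rewrite !mulr0.
  have: a \in U :\: S by rewrite e inE.
  by rewrite inE (negPf aU) andbF.
rewrite (bigD1 (U :\ a)) ?subD1set //= big1 ?addr0 => [|S /andP[sSU nS]].
  rewrite !ffunE setDDr setDv set0U (setIidPr _) ?sub1set // eqxx mulr1.
  rewrite -[in (-1) ^+ #|_|](@inversions1_add q a) ?setD11 // mulrA -exprD.
  by rewrite addnCA addnn exprD -mul2n exprM sqrrN !expr1n !mulr1.
rewrite !ffunE; case: eqP => [e|]; last by rewrite !mulr0.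
case/eqP: nS; apply/setP=> x; have /setP/(_ x) := e; rewrite !inE => <-.
by case xS: (x \in S) => //=; [rewrite (subsetP sSU) | rewrite andNb].
Qed.

Lemma spdX_spdX a b f : spdX a (spdX b f) = spdX b (spdX a f).
Proof. by apply: spP => S; rewrite !ffunE mderiv_comm. Qed.

Lemma spdX_spdXi a b f : spdX a (spdXi b f) = spdXi b (spdX a f).
Proof.
apply: spP => S; rewrite !ffunE; case: ifP => _; first by rewrite mderiv0.
by rewrite -signr_odd !mulr_sign; case: (odd _); rewrite ?mderivN.
Qed.

Lemma spdXi_spdXi a b f : spdXi a (spdXi b f) = - spdXi b (spdXi a f).
Proof.
apply: spP => S; rewrite !ffunE !inE [b == a]eq_sym.
case: (eqVneq a b) => [->|nab] /=; first by case: ifP; rewrite !(mulr0, oppr0).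
case: ifPn => aS; case: ifPn => bS; rewrite ?(mulr0, oppr0) //.
rewrite !inversionsU1r // !inversions11 !exprD setUCA.
by case: (ltngtP a b) nab => [_ _|_ _|/val_inj-> /eqP//]; rewrite ?expr1 ?expr0; ring.
Qed.

(** The sign automorphism met by an operator of parity b when it moves past an
element. *)
Definition twist (b : bool) f := if b then spparity f else f.

Fact twist_linear b : linear (twist b).
Proof. by case: b => c f g; rewrite /twist ?linearP. Qed.
HB.instance Definition _ b :=
  GRing.isLinear.Build K A A *:%R (twist b) (twist_linear b).

Fact twist_monoid_morphism b : monoid_morphism (twist b).
Proof. by case: b; split=> [|f g]; rewrite /twist ?rmorph1 ?rmorphM. Qed.
HB.instance Definition _ b :=
  GRing.isMonoidMorphism.Build A A (twist b) (twist_monoid_morphism b).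

Lemma spparityK f : spparity (spparity f) = f.
Proof.
by apply: spP => S; rewrite !ffunE mulrA -exprD addnn -mul2n exprM sqrrN !expr1n mul1r.
Qed.

Lemma twistD b c f : twist b (twist c f) = twist (b (+) c) f.
Proof. by case: b; case: c; rewrite /twist //= spparityK. Qed.

Definition superderivation (b : bool) (D : A -> A) : Prop :=
  forall f g, D (f * g) = D f * g + twist b f * D g.

End Parity.

Section Superderivations.
Variables (K : comNzRingType) (p q : nat).
Local Notation A := (superpoly K p q).

Lemma superderivation1 b (D : A -> A) : superderivation b D -> D 1 = 0.
Proof.
move=> dD; have := dD 1 1; rewrite rmorph1 !mul1r mulr1 => /eqP.
by rewrite -subr_eq subrr eq_sym => /eqP.
Qed.

Lemma superderivation_prod_eq0 b (D : A -> A) (I : eqType) (s : seq I) (F : I -> A) :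
  superderivation b D -> {in s, forall i, D (F i) = 0} -> D (\prod_(i <- s) F i) = 0.
Proof.
move=> dD; elim: s => [|i s IHs] F0; first by rewrite big_nil (superderivation1 dD).
rewrite big_cons dD F0 ?mem_head // mul0r IHs ?mulr0 ?addr0 // => j js.
by rewrite F0 // inE js orbT.
Qed.

Lemma superderivation_prod_eigen (D : A -> A) (I : eqType) (s : seq I)
    (F : I -> A) (w : I -> nat) :
    superderivation false D -> {in s, forall i, D (F i) = F i *+ w i} ->
  D (\prod_(i <- s) F i) = (\prod_(i <- s) F i) *+ \sum_(i <- s) w i.
Proof.
move=> dD; elim: s => [|i s IHs] Fw; first by rewrite !big_nil (superderivation1 dD).
rewrite !big_cons dD Fw ?mem_head // IHs => [|j js]; last by rewrite Fw // inE js orbT.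
by rewrite mulrnDr mulrnAl mulrnAr.
Qed.

Lemma superderivation_prod b (D : A -> A) (r : nat) (a : 'I_r -> A) :
    superderivation b D ->
  D (\prod_(i < r) a i) = \sum_(k < r) \prod_(i < r)
    (if (i < k)%N then twist b (a i) else if i == k then D (a i) else a i).
Proof.
move=> dD; elim: r a => [|r IHr] a; first by rewrite !big_ord0 (superderivation1 dD).
rewrite big_ord_recl dD IHr big_ord_recl big_ord_recl /= mulr_sumr.
congr (_ + _); apply: eq_bigr => k _; rewrite big_ord_recl /=; congr (_ * _).
Qed.

(** The case of a derivation that hits a single factor of the product. *)
Lemma superderivation_prod1 (D : A -> A) (r : nat) (a a' : 'I_r -> A) (k : 'I_r) :
    superderivation false D -> D (a k) = a' k ->
    (forall i, i != k -> D (a i) = 0 /\ a' i = a i) ->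
  D (\prod_(i < r) a i) = \prod_(i < r) a' i.
Proof.
move=> dD ak ai; rewrite (superderivation_prod _ dD) (bigD1 k) //=.
rewrite [X in _ + X]big1 ?addr0.
  apply: eq_bigr => i _; case: eqP => [->|/eqP nik]; first by rewrite ltnn.
  by have [_ ->] := ai i nik; rewrite if_same.
move=> j njk; apply: (@prod_eq0 _ _ _ j); rewrite ltnn eqxx.
by case: (ai j njk).
Qed.

Lemma superderivation_det b (D : {linear A -> A}) (r : nat) (M : 'M[A]_r) :
    superderivation b D ->
  D (\det M) = \sum_(k < r) \det (\matrix_(i, j)
    if (i < k)%N then twist b (M i j) else if i == k then D (M i j) else M i j).
Proof.
move=> dD; rewrite /determinant raddf_sum [RHS]exchange_big /=.
apply: eq_bigr => s _; rewrite -mulr_sumr.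
have <- : D (\prod_i M i (s i)) = \sum_(k < r) \prod_i (\matrix_(i, j)
    if (i < k)%N then twist b (M i j) else if i == k then D (M i j) else M i j) i (s i).
  rewrite (superderivation_prod _ dD); apply: eq_bigr => k _.
  by apply: eq_bigr => i _; rewrite mxE.
by rewrite !mulr_sign; case: ifP => _; rewrite ?raddfN.
Qed.

Lemma superderivation_det_eq0 b (D : {linear A -> A}) (r : nat) (M : 'M[A]_r) :
  superderivation b D -> (forall i j, D (M i j) = 0) -> D (\det M) = 0.
Proof.
move=> dD M0; rewrite raddf_sum big1 // => s _.
by rewrite mulr_sign; case: ifP => _; rewrite ?raddfN /=
  (superderivation_prod_eq0 dD) ?oppr0.
Qed.

(** The eigenvalue is asked for on each term of the expansion rather than on
each row: for the operators of gl(l) the row carrying the weight depends on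
the permutation. *)
Lemma superderivation_det_eigen (D : {linear A -> A}) (r : nat) (M : 'M[A]_r) w :
    superderivation false D ->
    (forall s : 'S_r, D (\prod_i M i (s i)) = (\prod_i M i (s i)) *+ w) ->
  D (\det M) = \det M *+ w.
Proof.
move=> dD Mw; rewrite raddf_sum -sumrMnl; apply: eq_bigr => s _ /=.
by rewrite !mulr_sign; case: ifP => _; rewrite ?raddfN /= Mw ?mulNrn.
Qed.

End Superderivations.

(** * The operators of gl(n|n) and gl(l) *)

Section Polarizations.
Variables (K : comNzRingType) (n l : nat).
Local Notation A := (superpoly K (n * l) (n * l)).
Implicit Types (a b c : 'I_(n + n)) (i : 'I_n) (j k m : 'I_l) (f g : A).

Definition odd_gen a : bool := (a < n)%N.

Lemma odd_lshift i : odd_gen (lshift n i).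
Proof. exact: (ltn_ord i). Qed.
Lemma odd_rshift i : odd_gen (rshift n i) = false.
Proof. by rewrite /odd_gen /= ltnNge leq_addr. Qed.

Lemma gen_lshift i j : gen K (lshift n i) j = xivar K i j.
Proof. by rewrite /gen (unsplitK (inl i)). Qed.
Lemma gen_rshift i j : gen K (rshift n i) j = xvar K i j.
Proof. by rewrite /gen (unsplitK (inr i)). Qed.
Lemma dgen_lshift i j f : dgen (lshift n i) j f = dxi i j f.
Proof. by rewrite /dgen (unsplitK (inl i)). Qed.
Lemma dgen_rshift i j f : dgen (rshift n i) j f = dx i j f.
Proof. by rewrite /dgen (unsplitK (inr i)). Qed.

Fact dgen_linear b j : linear (dgen b j : A -> A).
Proof.
move=> c f g; case: (split_ordP b) => i ->; rewrite ?dgen_lshift ?dgen_rshift.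
  exact: linearP.
exact: linearP.
Qed.
HB.instance Definition _ b j :=
  GRing.isLinear.Build K A A *:%R (dgen b j) (dgen_linear b j).

Lemma mxvec_index_eq i i' j j' :
  (mxvec_index i j == mxvec_index i' j') = (i == i') && (j == j').
Proof. by rewrite /mxvec_index (inj_eq (@cast_ord_inj _ _ _)) (inj_eq enum_rank_inj). Qed.

Lemma gen_comm a j f : gen K a j * f = twist (odd_gen a) f * gen K a j.
Proof.
case: (split_ordP a) => i ->; rewrite ?gen_lshift ?gen_rshift ?odd_lshift ?odd_rshift.
  exact: spXi_comm.
exact: spX_comm.
Qed.

Lemma twist_gen (e : bool) a j :
  twist e (gen K a j) = (-1) ^+ (e && odd_gen a) *: gen K a j.
Proof.
case: (split_ordP a) => i ->; rewrite ?gen_lshift ?gen_rshift ?odd_lshift ?odd_rshift.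
  by case: e; rewrite ?scaleN1r ?scale1r //= spparity_Xi.
by rewrite andbF scale1r; case: e => //=; rewrite spparity_X.
Qed.

Lemma dgen_superderivation b j : superderivation (odd_gen b) (dgen b j : A -> A).
Proof.
move=> f g; case: (split_ordP b) => i ->.
  by rewrite !dgen_lshift odd_lshift; apply: spdXi_Leibniz.
by rewrite !dgen_rshift odd_rshift; apply: spdX_Leibniz.
Qed.

Lemma dgen_gen a b j k : dgen b k (gen K a j) = ((b == a) && (k == j))%:R.
Proof.
case: (split_ordP a) => i ->; case: (split_ordP b) => i' ->;
  rewrite ?gen_lshift ?gen_rshift ?dgen_lshift ?dgen_rshift
    ?eq_lshift ?eq_rshift ?eq_lrshift ?eq_rlshift /= -?mxvec_index_eq.
- exact: spdXi_Xi.
- exact: spdX_Xi.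
- exact: spdXi_X.
- exact: spdX_X.
Qed.

Lemma dgen_comm a b j k f : dgen a j (dgen b k f) =
  (-1) ^+ (odd_gen a && odd_gen b) *: dgen b k (dgen a j f).
Proof.
case: (split_ordP a) => i ->; case: (split_ordP b) => i' ->;
  rewrite ?dgen_lshift ?dgen_rshift ?odd_lshift ?odd_rshift ?scaleN1r ?scale1r.
- exact: spdXi_spdXi.
- by symmetry; apply: spdX_spdXi.
- exact: spdX_spdXi.
- exact: spdX_spdX.
Qed.

Definition glnn_op a b f : A := \sum_j gen K a j * dgen b j f.

Definition gll_op j k f : A := \sum_a gen K a j * dgen a k f.

Fact glnn_op_linear a b : linear (glnn_op a b).
Proof.
move=> c f g; rewrite /glnn_op scaler_sumr -big_split; apply: eq_bigr => j _ /=.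
by rewrite linearP mulrDr scalerAr.
Qed.
HB.instance Definition _ a b :=
  GRing.isLinear.Build K A A *:%R (glnn_op a b) (glnn_op_linear a b).

Fact gll_op_linear j k : linear (gll_op j k).
Proof.
move=> c f g; rewrite /gll_op scaler_sumr -big_split; apply: eq_bigr => a _ /=.
by rewrite linearP mulrDr scalerAr.
Qed.
HB.instance Definition _ j k :=
  GRing.isLinear.Build K A A *:%R (gll_op j k) (gll_op_linear j k).

Lemma gen_dgen_superderivation a b j k :
  superderivation (odd_gen a (+) odd_gen b) (fun f => gen K a j * dgen b k f).
Proof.
move=> f g; rewrite dgen_superderivation mulrDr !mulrA; congr (_ + _ * _).
by rewrite gen_comm twistD.
Qed.

Lemma glnn_op_superderivation a b :
  superderivation (odd_gen a (+) odd_gen b) (glnn_op a b).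
Proof.
move=> f g; rewrite mulr_suml mulr_sumr -big_split; apply: eq_bigr => j _ /=.
exact: gen_dgen_superderivation.
Qed.

Lemma gll_op_derivation j k : superderivation false (gll_op j k).
Proof.
move=> f g; rewrite mulr_suml mulr_sumr -big_split; apply: eq_bigr => a _ /=.
by rewrite gen_dgen_superderivation addbb.
Qed.

Lemma glnn_op_gen a b c j : glnn_op a b (gen K c j) = gen K a j *+ (b == c).
Proof.
rewrite /glnn_op (bigD1 j) //= big1 ?addr0 => [|k nkj]; rewrite dgen_gen.
  by rewrite eqxx andbT mulr_natr.
by rewrite (negPf nkj) andbF mulr0.
Qed.

Lemma gll_op_gen j k c m : gll_op j k (gen K c m) = gen K c j *+ (k == m).
Proof.
rewrite /gll_op (bigD1 c) //= big1 ?addr0 => [|a nac]; rewrite dgen_gen.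
  by rewrite eqxx mulr_natr.
by rewrite (negPf nac) mulr0.
Qed.

(** E_(a b) is, up to sign, the supercommutator of E_(a c) and E_(c b).  Instead
of computing it, expand E_(a c) (E_(c b) f) = 0 by the Leibniz rule: the term
other than E_(a b) f contains E_(a c) (d/de^b_j f), which is, up to sign,
d/de^b_j (E_(a c) f) since a and b differ. *)
Lemma glnn_op_commutator a b c f : a != b ->
  glnn_op a c f = 0 -> glnn_op c b f = 0 -> glnn_op a b f = 0.
Proof.
move=> nab acf cbf; have: glnn_op a c (glnn_op c b f) = 0 by rewrite cbf linear0.
rewrite {2}/glnn_op linear_sum /=.
rewrite (eq_bigr (fun j => gen K a j * dgen b j f)) // => j _.
rewrite glnn_op_superderivation glnn_op_gen eqxx.
suff -> : glnn_op a c (dgen b j f) = 0 by rewrite mulr0 addr0.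
have: dgen b j (glnn_op a c f) = 0 by rewrite acf linear0.
rewrite /glnn_op linear_sum /=.
rewrite (eq_bigr (fun k => (-1) ^+ (odd_gen b && (odd_gen a (+) odd_gen c)) *:
  (gen K a k * dgen c k (dgen b j f)))) => [|k _].
  rewrite -scaler_sumr; set e := _ && _ => /(congr1 ( *:%R ((-1) ^+ e))).
  by rewrite scalerA -expr2 sqrr_sign scale1r scaler0.
rewrite dgen_superderivation dgen_gen eq_sym (negPf nab) mul0r add0r twist_gen.
rewrite dgen_comm -scalerAl -scalerAr scalerA.
by case: (odd_gen a); case: (odd_gen b); case: (odd_gen c);
  rewrite /= ?expr0 ?expr1 ?mulrNN ?mul1r ?mulr1.
Qed.

End Polarizations.

(** * Determinants with one letter per row *)

Section GeneratorDeterminants.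
Variables (K : comNzRingType) (n l r : nat) (le_rl : (r <= l)%N).
Variable rho : 'I_r -> 'I_(n + n).
Local Notation A := (superpoly K (n * l) (n * l)).
Implicit Types (a b : 'I_(n + n)) (j m : 'I_l).

(** The factors of the highest weight vector have this shape, and so do, up to
sign, the terms that an E_(a b) produces from them. *)
Definition gen_det : A :=
  \det (\matrix_(p < r, c < r) gen K (rho p) (widen_ord le_rl c)).

Lemma dgen_gen_det_eq0 b m :
  (forall p, rho p != b) \/ (r <= m)%N -> dgen b m gen_det = 0.
Proof.
move=> h; apply: (superderivation_det_eq0 (@dgen_superderivation K n l b m)).
move=> p c; rewrite mxE /= dgen_gen; case: h => [/(_ p)|le_rm].
  by rewrite eq_sym => /negPf->.
rewrite [m == _](_ : _ = false) ?andbF //; apply/eqP => e.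
by move: le_rm; rewrite e leqNgt /= ltn_ord.
Qed.

Lemma glnn_op_gen_det_absent a b :
  (forall p, rho p != b) -> glnn_op a b gen_det = 0.
Proof.
by move=> nb; rewrite /glnn_op big1 // => j _; rewrite dgen_gen_det_eq0 ?mulr0 //; left.
Qed.

(** Each occurrence of the letter b becomes a second row a, and the entries of
an even row are central. *)
Lemma glnn_op_gen_det_repeated a b : ~~ odd_gen a ->
    (forall p, rho p = b -> exists2 q, q != p & rho q = a) ->
  glnn_op a b gen_det = 0.
Proof.
move=> ea ba; rewrite /gen_det.
rewrite (superderivation_det _ (@glnn_op_superderivation _ _ _ a b)).
rewrite big1 // => p _; have [/[dup] pb /ba[q nqp qa]|npb] := eqVneq (rho p) b.
  apply: (@det_equal_central_rows _ _ _ p q); first by rewrite eq_sym.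
    move=> c; rewrite !mxE /= ltnn eqxx glnn_op_gen pb eqxx mulr1n (negPf nqp) qa.
    by rewrite twist_gen (negPf ea) andbF scale1r if_same.
  move=> c f; rewrite mxE ltnn eqxx mxE /= glnn_op_gen pb eqxx mulr1n.
  by rewrite gen_comm (negPf ea).
rewrite /determinant big1 // => s _; rewrite (@prod_eq0 _ _ _ p) ?mulr0 //.
by rewrite mxE ltnn eqxx mxE /= glnn_op_gen eq_sym (negPf npb).
Qed.

Lemma glnn_op_gen_det_diag a :
  glnn_op a a gen_det = gen_det *+ #|[pred p | rho p == a]|.
Proof.
have dE := @glnn_op_superderivation K n l a a; rewrite addbb in dE.
apply: superderivation_det_eigen => // s /=.
rewrite (superderivation_prod_eigen (w := fun p => (rho p == a) : nat) dE) //.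
  congr (_ *+ _); rewrite -sum1_card [RHS]big_mkcond; apply: eq_bigr => p _.
  by rewrite inE; case: eqP.
by move=> p _; rewrite mxE glnn_op_gen eq_sym; case: eqP => // ->.
Qed.

Lemma gll_op_gen_det_diag j : gll_op j j gen_det = gen_det *+ (j < r)%N.
Proof.
have dC := @gll_op_derivation K n l j j.
apply: superderivation_det_eigen => // s /=.
rewrite (superderivation_prod_eigen (w := fun p => (s p == j :> nat) : nat) dC);
  last first.
  by move=> p _; rewrite mxE gll_op_gen eq_sym -val_eqE /=; case: eqP => // e;
    congr (gen K _ _ *+ _); apply/val_inj.
congr (_ *+ _); case: ltnP => [lt_jr|le_rj]; last first.
  by rewrite big1 // => p _; rewrite ltn_eqF // (leq_trans (ltn_ord _)).
rewrite (bigD1 (s^-1%g (Ordinal lt_jr))) //= permKV eqxx big1 // => p np.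
case: eqP => // e; case/eqP: np; apply: (@perm_inj _ s); rewrite permKV.
exact/val_inj.
Qed.

Lemma gll_op_gen_det_eq0 j m :
  j != m -> (j < r)%N || (j < m)%N -> gll_op j m gen_det = 0.
Proof.
move=> njm hj; have [lt_mr|le_rm] := ltnP m r; last first.
  rewrite /gll_op big1 // => a _; rewrite dgen_gen_det_eq0 ?mulr0 //; by right.
have lt_jr : (j < r)%N by case/orP: hj => // /ltn_trans; apply.
have dC := @gll_op_derivation K n l j m.
pose j' := Ordinal lt_jr; pose m' := Ordinal lt_mr.
have njm' : m' != j' by rewrite eq_sym.
have ej : widen_ord le_rl j' = j by apply/val_inj.
pose M : 'M[A]_r := \matrix_(p, c)
  gen K (rho p) (widen_ord le_rl (if c == m' then j' else c)).
suff -> : gll_op j m gen_det = \det M.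
  by apply: (det_equal_columns njm') => p; rewrite !mxE eqxx if_same.
rewrite /gen_det /determinant linear_sum; apply: eq_bigr => s _ /=.
have E : gll_op j m (\prod_p (\matrix_(p, c) gen K (rho p) (widen_ord le_rl c)) p (s p))
    = \prod_p M p (s p).
  apply: (superderivation_prod1 (k := s^-1%g m') dC).
    rewrite !mxE gll_op_gen permKV eqxx ej -val_eqE /= eqxx //.
  move=> p np; have nsp : s p != m'.
    by apply: contraNneq np => e; apply/eqP/(@perm_inj _ s); rewrite permKV.
  rewrite !mxE gll_op_gen (negPf nsp) [_ == _](_ : _ = false) //.
  by apply/negbTE; rewrite eq_sym.
by rewrite !mulr_sign; case: ifP => _; rewrite ?linearN /= E.
Qed.

(** Both sides equal the sum over m of e^a_m C_(j m) D: only m = j survives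
there, and exchanging the two sums collects the operators E_(a b).  This
replaces the expansion of a determinant with a repeated column, which would
need cofactors over a noncommutative ring. *)
Lemma gen_mul_gen_det a j : (j < r)%N -> gen K a j * gen_det =
  \sum_b (-1) ^+ (odd_gen a && odd_gen b) *: (gen K b j * glnn_op a b gen_det).
Proof.
move=> lt_jr; have <- : \sum_m gen K a m * gll_op j m gen_det = gen K a j * gen_det.
  rewrite (bigD1 j) //= gll_op_gen_det_diag lt_jr big1 ?addr0 // => m nmj.
  by rewrite gll_op_gen_det_eq0 ?mulr0 ?lt_jr // eq_sym.
rewrite /gll_op; under eq_bigr do rewrite mulr_sumr.
rewrite exchange_big; apply: eq_bigr => b _ /=.
rewrite /glnn_op mulr_sumr scaler_sumr; apply: eq_bigr => m _.
by rewrite mulrA gen_comm twist_gen -!scalerAl -mulrA.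
Qed.

(** In the preceding identity the term b = a of the right-hand side is minus a
multiple of the left-hand side; moving it to the left gives the factor. *)
Lemma xi_mul_gen_det (a : 'I_n) j : (j < r)%N ->
    (forall p, odd_gen (rho p) -> rho p = lshift n a) ->
  xivar K a j * gen_det *+ #|[pred p | rho p == lshift n a]|.+1 =
    \sum_(i < n) xvar K i j * glnn_op (lshift n a) (rshift n i) gen_det.
Proof.
move=> lt_jr only_a; rewrite -gen_lshift mulrS {1}gen_mul_gen_det //.
rewrite big_split_ord /= odd_lshift (bigD1 a) //= [X in _ + X + _ + _]big1 => [|b nba].
  rewrite odd_lshift glnn_op_gen_det_diag addr0 scaleN1r mulrnAr addrC addrA.
  rewrite subrr add0r; apply: eq_bigr => i _.
  by rewrite odd_rshift scale1r gen_rshift.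
rewrite glnn_op_gen_det_absent ?mulr0 ?scaler0 // => p.
apply: contraNneq nba => e; move: (only_a p); rewrite e odd_lshift => /(_ isT)/eqP.
by rewrite eq_lshift eq_sym.
Qed.
End GeneratorDeterminants.

(** * The factors of the highest weight vector *)

Section ColumnDeterminants.
Variables (K : numDomainType) (n l : nat) (le_ln : (l <= n)%N).
Variables (lam : seq nat) (lam_len : (size lam <= l)%N).
Local Notation A := (superpoly K (n * l) (n * l)).

Lemma superpoly_natmul_eq0 (f : A) d : f *+ d.+1 = 0 -> f = 0.
Proof.
move=> fd0; apply: spP => S; apply/mpolyP => m.
have : (spcoef (f *+ d.+1) S)@_m = 0 by rewrite fd0 spcoef0 mcoeff0.
have -> : spcoef (f *+ d.+1) S = spcoef f S *+ d.+1.
  by elim: (d.+1) => [|e IHe]; rewrite ?spcoef0 // !mulrS spcoefD IHe.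
by rewrite mcoeffMn spcoef0 mcoeff0 => /eqP; rewrite mulrn_eq0 => /eqP.
Qed.

(** The letter of row p in the k-th determinant; the entries of the matrix X^k
are the coordinates of these letters. *)
Definition row_label (r : nat) (le_rl : (r <= l)%N) (k : nat) (p : 'I_r) : 'I_(n + n) :=
  if (p < k.-1)%N then rshift n (widen_ord le_ln (widen_ord le_rl p))
  else lshift n (widen_ord le_ln (ord_min k.-1 (widen_ord le_rl p))).

Lemma row_label_rshift r (le_rl : (r <= l)%N) k p i :
  (row_label le_rl k p == rshift n i) = (p == i :> nat) && (i < k.-1)%N.
Proof.
rewrite /row_label; case: ifPn => pk; rewrite ?eq_rshift ?eq_lrshift -?val_eqE /=.
  by case: eqP => // <-.
by case: eqP => // <-; rewrite (negPf pk).
Qed.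

Lemma row_label_lshift r (le_rl : (r <= l)%N) k p i :
  (row_label le_rl k p == lshift n i) = (i == k.-1 :> nat) && (k.-1 <= p)%N.
Proof.
rewrite /row_label; case: ltnP => pk; rewrite ?eq_lshift ?eq_rlshift -?val_eqE /=.
  by rewrite andbF.
by rewrite (minn_idPl pk) andbT eq_sym.
Qed.

Local Notation height k := (column_length lam k).
Local Notation le_height k := (column_length_leq lam_len k).
Local Notation label k := (row_label (le_height k) k).

Definition column_det k : A := gen_det K (le_height k) (label k).

Lemma column_detE k :
  \det (upper_left (le_height k) (Xmx K le_ln k)) = column_det k.
Proof.
congr (\det _); apply/matrixP=> p c; rewrite !mxE /row_label /=.
by case: ifP; rewrite ?gen_rshift ?gen_lshift.
Qed.

Lemma column_length_anti k k' : (k <= k')%N -> (height k' <= height k)%N.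
Proof. by move=> kk'; apply: sub_count => part; apply: leq_trans. Qed.

Lemma gll_op_column_det (j j' : 'I_l) k : (j < j')%N -> gll_op j j' (column_det k) = 0.
Proof.
by move=> jj'; rewrite gll_op_gen_det_eq0 ?jj' ?orbT // -val_eqE /= ltn_eqF.
Qed.

Lemma glnn_op_x_xi_column_det (i i' : 'I_n) k : i' = i.+1 :> nat ->
  glnn_op (rshift n i) (lshift n i') (column_det k) = 0.
Proof.
move=> ei'; apply: glnn_op_gen_det_repeated; rewrite ?odd_rshift // => p /eqP.
rewrite row_label_lshift ei' => /andP[/eqP ek kp].
have lt_ip : (i < p)%N by rewrite (leq_trans _ kp) // -ek.
exists (Ordinal (ltn_trans lt_ip (ltn_ord p))); first by rewrite -val_eqE /= ltn_eqF.
by apply/eqP; rewrite row_label_rshift eqxx -ek /=.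
Qed.

Lemma glnn_op_x_x_column_det (i i' : 'I_n) k : (i < i')%N ->
  glnn_op (rshift n i) (rshift n i') (column_det k) = 0.
Proof.
move=> ii'; apply: glnn_op_gen_det_repeated; rewrite ?odd_rshift // => p /eqP.
rewrite row_label_rshift => /andP[/eqP ep kp].
have lt_ip : (i < p)%N by rewrite ep.
exists (Ordinal (ltn_trans lt_ip (ltn_ord p))); first by rewrite -val_eqE /= ltn_eqF.
by apply/eqP; rewrite row_label_rshift eqxx /= (ltn_trans ii').
Qed.

Lemma glnn_op_x_absent a (i : 'I_n) k : (k.-1 <= i)%N ->
  glnn_op a (rshift n i) (column_det k) = 0.
Proof.
move=> ki; apply: glnn_op_gen_det_absent => p.
by rewrite row_label_rshift ltnNge ki andbF.
Qed.

Lemma odd_row_label k p (i : 'I_n) : i = k.-1 :> nat ->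
  odd_gen (label k p) -> label k p = lshift n i.
Proof.
move=> ei; rewrite {1}/row_label; case: ltnP => kp; rewrite ?odd_rshift // => _.
by apply/eqP; rewrite row_label_lshift ei eqxx.
Qed.

(** The factors up to the index i + 1 are killed one by one.  The later ones,
w, are killed only after multiplication by D, the factor of index i + 1: a
multiple of D xi^i_j is a combination of the x^p_j with p < i, which turns the
operator acting on w into the operators x^p d/dx^i, and these kill w. *)
Lemma glnn_op_xi_x_prod (i : 'I_n) m :
  glnn_op (lshift n i) (rshift n i) (\prod_(1 <= k < m) column_det k) = 0.
Proof.
set E := glnn_op _ _; have dE : superderivation true E.
  by have := @glnn_op_superderivation K n l (lshift n i) (rshift n i);
    rewrite odd_lshift odd_rshift.
have E0 k : (k < i.+2)%N -> E (column_det k) = 0.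
  by move=> ki; apply: glnn_op_x_absent; case: k ki.
have [le_mi|lt_im] := leqP m i.+1.
  apply: (superderivation_prod_eq0 dE) => k; rewrite mem_index_iota => /andP[_ km].
  by apply: E0; rewrite (leq_trans km) // ltnW.
rewrite (big_cat_nat _ (n := i.+2)) //= dE.
rewrite (superderivation_prod_eq0 dE) => [|k]; last first.
  by rewrite mem_index_iota => /andP[_]; apply: E0.
rewrite big_nat_recr //= mul0r add0r rmorphM -mulrA.
set D := column_det i.+1; set w := \prod_(i.+2 <= k < m) _.
suff -> : twist true D * E w = 0 by rewrite mulr0.
(* The columns of w are among those of D, the only ones where xi_mul_gen_det
   applies. *)
have w0 (j : 'I_l) : (height i.+1 <= j)%N -> dgen (rshift n i) j w = 0.
  move=> hj; apply: (superderivation_prod_eq0 (@dgen_superderivation K n l _ j)) => k.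
  rewrite mem_index_iota => /andP[ik _]; apply: dgen_gen_det_eq0; right.
  by apply: leq_trans hj; apply/column_length_anti/ltnW.
set c := #|[pred p | label i.+1 p == lshift n i]|.
apply: (@superpoly_natmul_eq0 _ c).
rewrite /E /glnn_op mulr_sumr -sumrMnl.
transitivity (\sum_(p < n) glnn_op (lshift n i) (rshift n p) D *
    glnn_op (rshift n p) (rshift n i) w).
  under [RHS]eq_bigr do rewrite [X in _ * X]/glnn_op mulr_sumr.
  rewrite [RHS]exchange_big; apply: eq_bigr => j _.
  have [lt_jr|le_rj] := ltnP j (height i.+1); last first.
    by rewrite w0 // !mulr0 mul0rn big1 // => p _; rewrite !mulr0.
  (* The sign in the parity twist of D is the one of moving xi^i_j past D. *)
  have -> : twist true D * (gen K (lshift n i) j * dgen (rshift n i) j w) =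
      xivar K i j * D * dgen (rshift n i) j w.
    by rewrite mulrA -gen_lshift gen_comm odd_lshift.
  rewrite -mulrnAl xi_mul_gen_det //; last by move=> p; apply: odd_row_label.
  rewrite mulr_suml; apply: eq_bigr => p _.
  by rewrite -gen_rshift gen_comm odd_rshift mulrA.
rewrite big1 // => p _; have [lt_pi|le_ip] := ltnP p i; last first.
  by rewrite glnn_op_x_absent ?mul0r.
rewrite (superderivation_prod_eq0 (@glnn_op_superderivation K n l _ _)) ?mulr0 // => k _.
exact: glnn_op_x_x_column_det.
Qed.
End ColumnDeterminants.

(** * From simple root vectors to highest weight vectors *)

Section HighestWeight.
Variables (K : numDomainType) (n l : nat).
Local Notation A := (superpoly K (n * l) (n * l)).
Implicit Types (a b c : 'I_(n + n)) (v : A).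

Lemma gll_op_split (j k : 'I_l) v : gll_op j k v =
  \sum_(i < n) xivar K i j * dxi i k v + \sum_(i < n) xvar K i j * dx i k v.
Proof.
rewrite /gll_op big_split_ord /=; congr (_ + _); apply: eq_bigr => i _.
  by rewrite gen_lshift dgen_lshift.
by rewrite gen_rshift dgen_rshift.
Qed.

Lemma interleaved_lshift (i : 'I_n) : interleaved (lshift n i) = i.*2.
Proof. by rewrite /interleaved (unsplitK (inl i)). Qed.
Lemma interleaved_rshift (i : 'I_n) : interleaved (rshift n i) = i.*2.+1.
Proof. by rewrite /interleaved (unsplitK (inr i)). Qed.

Lemma interleaved_inj : injective (@interleaved n).
Proof.
move=> a b; case: (split_ordP a) => i ->; case: (split_ordP b) => i' ->;
  rewrite ?interleaved_lshift ?interleaved_rshift => e.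
- by congr lshift; apply/val_inj/double_inj.
- by have := congr1 odd e; rewrite /= !odd_double.
- by have := congr1 odd e; rewrite /= !odd_double.
- by congr rshift; apply/val_inj/double_inj/succn_inj.
Qed.

Lemma interleaved_next a b : (interleaved a < interleaved b)%N ->
  exists c, interleaved c = (interleaved a).+1.
Proof.
case: (split_ordP a) => i ->; rewrite ?interleaved_lshift ?interleaved_rshift.
  by exists (rshift n i); rewrite interleaved_rshift.
move=> lt_ib; have lt_in : (i.+1 < n)%N.
  have : (i.*2.+2 < n.*2)%N.
    apply: leq_ltn_trans lt_ib _; case: (split_ordP b) => i' ->.
      by rewrite interleaved_lshift ltn_double.
    by rewrite interleaved_rshift ltn_Sdouble.
  by rewrite -doubleS ltn_double.
by exists (lshift n (Ordinal lt_in)); rewrite interleaved_lshift.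
Qed.

(** The simple roots join consecutive letters of the interleaved order; the
others follow by induction on the distance, through the letter next to a. *)
Lemma glnn_op_positive_root v :
    (forall i : 'I_n, glnn_op (lshift n i) (rshift n i) v = 0) ->
    (forall i i' : 'I_n, i' = i.+1 :> nat ->
      glnn_op (rshift n i) (lshift n i') v = 0) ->
  forall a b, (interleaved a < interleaved b)%N -> glnn_op a b v = 0.
Proof.
move=> even_root odd_root.
have simple a b : interleaved b = (interleaved a).+1 -> glnn_op a b v = 0.
  case: (split_ordP a) => i ->; case: (split_ordP b) => i' ->;
    rewrite ?interleaved_lshift ?interleaved_rshift => e.
  - by have := congr1 odd e; rewrite /= !odd_double.
  - by have /val_inj -> := double_inj (succn_inj e); apply: even_root.
  - by apply: odd_root; apply: double_inj; rewrite e.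
  - by have := congr1 odd e; rewrite /= !odd_double.
move=> a b; have [d] := ubnP (interleaved b - interleaved a).
elim: d a => // d IHd a le_ab lt_ab.
have [c ec] := interleaved_next lt_ab.
have [ecb|lt_cb] : interleaved c = interleaved b \/ (interleaved c < interleaved b)%N.
  by apply/predU1P; rewrite -leq_eqVlt ec.
  by apply: simple; rewrite -ecb.
apply: (@glnn_op_commutator _ _ _ _ _ c); last 2 first.
- exact: simple.
- apply: IHd => //; rewrite -ltnS; apply: leq_trans le_ab.
  by rewrite ltnS ltn_sub2l // ec.
by apply: contraTneq lt_ab => ->; rewrite ltnn.
Qed.

Lemma highest_weight_vectorP v (wa : 'I_(n + n) -> nat) (wj : 'I_l -> nat) :
    v != 0 ->
    (forall a b, (interleaved a < interleaved b)%N -> glnn_op a b v = 0) ->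
    (forall j k : 'I_l, (j < k)%N -> gll_op j k v = 0) ->
    (forall a, glnn_op a a v = v *+ wa a) ->
    (forall j, gll_op j j v = v *+ wj j) ->
  highest_weight_vector v.
Proof.
move=> nzv root root' wtE wtE'; split=> // [M P [bM dM] [bP dP]|].
  rewrite /gl_act /glnn_act /gll_act !big1 ?addr0 // => [j _|a _]; rewrite big1 // => b _.
    rewrite -gll_op_split; case: (ltngtP j b) => [lt_jb|lt_bj|/val_inj <-].
    - by rewrite root' ?scaler0.
    - by rewrite bP ?scale0r.
    - by rewrite dP scale0r.
  case: (ltngtP (interleaved a) (interleaved b)) => [lt_ab|lt_ba|/interleaved_inj <-].
  - by rewrite -/(glnn_op a b v) root ?scaler0.
  - by rewrite bM ?scale0r.
  - by rewrite dM scale0r.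
exists (\row_a (wa a)%:R), (\row_j (wj j)%:R) => h h'.
rewrite /gl_act scalerDl !scaler_suml; congr (_ + _); apply: eq_bigr => a _.
  rewrite (bigD1 a) //= [X in _ + X]big1 => [|b nba]; last first.
    by rewrite mxE eq_sym (negPf nba) scale0r.
  by rewrite -/(glnn_op a a v) wtE !mxE eqxx addr0 mulr1n -scalerA scaler_nat.
rewrite (bigD1 a) //= [X in _ + X]big1 => [|b nba]; last first.
  by rewrite mxE eq_sym (negPf nba) scale0r.
by rewrite -gll_op_split wtE' !mxE eqxx addr0 mulr1n -scalerA scaler_nat.
Qed.
End HighestWeight.

(** * Products of anticommuting elements *)

Section AnticommutingProducts.
Variables (A : pzRingType) (r : nat).
Implicit Types (L : seq 'I_r) (y : 'I_r -> A).

Definition anticommuting y := forall i j, y i * y j = - (y j * y i).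

Lemma anticommuting_prod y L i : anticommuting y ->
  y i * \prod_(x <- L) y x = (-1) ^+ size L * (\prod_(x <- L) y x * y i).
Proof.
move=> yA; elim: L => [|j L IHL] /=; first by rewrite big_nil !mul1r mulr1.
by rewrite big_cons mulrA yA exprS mulN1r !mulNr -!mulrA IHL !mulrA commr_sign.
Qed.

(** Whatever their number, the elements in between are crossed twice and
contribute no sign. *)
Lemma anticommuting_swap y L i j : anticommuting y ->
  y j * (\prod_(x <- L) y x * y i) = - (y i * (\prod_(x <- L) y x * y j)).
Proof.
move=> yA; rewrite !mulrA !anticommuting_prod // -!mulrA (yA i j).
by rewrite !mulrN opprK.
Qed.

Lemma anticommuting_tperm_split y u1 u2 u3 i j : anticommuting y ->
    uniq (u1 ++ i :: u2 ++ j :: u3) ->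
  \prod_(x <- u1 ++ i :: u2 ++ j :: u3) y (tperm i j x) =
    - \prod_(x <- u1 ++ i :: u2 ++ j :: u3) y x.
Proof.
move=> yA uL; rewrite !(big_cat, big_cons) /= tpermL tpermR.
have fix_out (u : seq 'I_r) : i \notin u -> j \notin u ->
    \prod_(x <- u) y (tperm i j x) = \prod_(x <- u) y x.
  move=> ni nj; apply: eq_big_seq => x xu; rewrite tpermD //.
    by apply: contraNneq ni => ->.
  by apply: contraNneq nj => ->.
move: uL; rewrite cat_uniq /= has_cat /= cat_uniq /= mem_cat inE !negb_or.
case/and5P=> _ /and4P[i1 _ j1 _] /and3P[i2 _ i3] _ /andP[/andP[j2 _] /andP[j3 _]].
rewrite !fix_out // -mulrN [in RHS]mulrA [in RHS]mulrA -[in RHS](mulrA (y i)) -mulNr.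
by rewrite -anticommuting_swap // -!mulrA.
Qed.

Lemma anticommuting_tperm y L i j : anticommuting y -> uniq L ->
    i \in L -> j \in L -> i != j ->
  \prod_(x <- L) y (tperm i j x) = - \prod_(x <- L) y x.
Proof.
move=> yA uL iL jL nij; case/splitPr: iL uL jL => u1 u2 uL.
rewrite mem_cat inE eq_sym (negPf nij) /= => /orP[] ju.
  case/splitPr: ju uL => v1 v2; rewrite -catA /= tpermC.
  exact: anticommuting_tperm_split.
by case/splitPr: ju uL => v1 v2; apply: anticommuting_tperm_split.
Qed.

(** By induction on the support of s: composing with a transposition makes one
more point fixed, and both sides change sign. *)
Lemma anticommuting_perm y L (s : 'S_r) : anticommuting y -> uniq L ->
    (forall x, x \notin L -> s x = x) ->
  \prod_(x <- L) y (s x) = (-1) ^+ s * \prod_(x <- L) y x.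
Proof.
move=> yA uL; have [d] := ubnP #|[pred x | s x != x]|.
elim: d s => // d IHd s le_d sL.
have [i nsi|s1] := pickP [pred x | s x != x]; last first.
  have -> : s = 1%g.
    by apply/permP=> x; rewrite perm1; apply/eqP; apply: contraFT (s1 x).
  by rewrite odd_perm1 mul1r; apply: eq_bigr => x _; rewrite perm1.
rewrite /= in nsi; pose j := (s^-1)%g i.
have sj : s j = i by rewrite /j permKV.
have nij : i != j by apply: contraNneq nsi => e; rewrite {1}e sj.
pose s' := (tperm i j * s)%g.
have es : s = (tperm i j * s')%g by rewrite /s' mulgA tperm2 mul1g.
have s'i : s' i = i by rewrite permM tpermL.
have fix_s' x : s x = x -> s' x = x.
  move=> sx; rewrite permM tpermD //; first by apply: contraNneq nsi => ->; apply/eqP.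
  by apply: contraNneq nij => e; rewrite -sj e sx.
have inL x : s x != x -> x \in L.
  by move=> nsx; apply: contraNT nsx => /sL ->.
rewrite {1}es (eq_bigr (fun x => y (s' (tperm i j x)))) => [|x _]; last by rewrite permM.
have yA' : anticommuting (y \o s') by move=> x x'; apply: yA.
rewrite (anticommuting_tperm yA' uL) ?inL ?sj // IHd.
- by rewrite es odd_permM odd_tperm nij /= signrN mulNr.
- apply: leq_trans (_ : _ < #|[pred x | s x != x]|)%N le_d.
  apply: proper_card; apply/properP; split.
    by apply/subsetP=> x; rewrite !inE; apply: contraNN => /eqP/fix_s' ->.
  by exists i; rewrite !inE ?s'i ?eqxx.
by move=> x /sL; apply: fix_s'.
Qed.
End AnticommutingProducts.

(** * Non-vanishing *)

Section Evaluation.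
Variables (K : comNzRingType) (p q : nat) (x : 'I_p -> K).
Local Notation A := (superpoly K p q).

Definition speval (f : A) : A := Superpoly [ffun S => ((spcoef f S).@[x])%:MP].

Fact speval_linear : linear speval.
Proof.
move=> c f g; apply: spP => S.
by rewrite !ffunE mevalD mevalZ mpolyCD mpolyCM mul_mpolyC.
Qed.
HB.instance Definition _ := GRing.isLinear.Build K A A *:%R speval speval_linear.

Fact speval_monoid_morphism : monoid_morphism speval.
Proof.
split=> [|f g]; apply: spP => U.
  by rewrite !ffunE mevalMn meval1 mpolyCMn.
rewrite !ffunE (big_morph (fun P : {mpoly K[p]} => (P.@[x])%:MP) (id1 := 0)
  (op1 := +%R)) => [|P Q|]; rewrite ?mevalD ?mpolyCD ?meval0 ?mpolyC0 //.
apply: eq_bigr => S _.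
rewrite /= !ffunE -signr_odd !mulr_sign; case: (odd _).
  by rewrite mevalN mevalM mpolyCN mpolyCM.
by rewrite mevalM mpolyCM.
Qed.
HB.instance Definition _ :=
  GRing.isMonoidMorphism.Build A A speval speval_monoid_morphism.

Lemma speval_X (a : 'I_p) : speval (spX K q a) = x a *: 1.
Proof.
apply: spP => S; rewrite !ffunE; case: eqP => _; last by rewrite meval0 mpolyC0 scaler0.
by rewrite mevalXU alg_mpolyC.
Qed.

Lemma speval_Xi (a : 'I_q) : speval (spXi K p a) = spXi K p a.
Proof. by apply: spP => S; rewrite !ffunE mevalMn meval1 mpolyCMn. Qed.
End Evaluation.

Section NonVanishing.
Variables (K : numDomainType) (n l : nat) (le_ln : (l <= n)%N).
Variables (lam : seq nat) (lam_len : (size lam <= l)%N).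
Local Notation A := (superpoly K (n * l) (n * l)).
Local Notation height k := (column_length lam k).
Local Notation le_height k := (column_length_leq lam_len k).
Local Notation label k := (row_label le_ln (le_height k) k).
Local Notation D k := (column_det K le_ln lam_len k).

Definition identity_point : 'I_(n * l) -> K :=
  mxvec (\matrix_(i < n, j < l) (i == j :> nat)%:R) 0.

(** At the identity point the row x^p is the p-th unit vector, so only the
permutations fixing every p < k - 1 contribute.  Each contributes the same
monomial: the sign of the permutation appears once in the determinant and once
in reordering the odd variables.  The factor is the number of these
permutations.  The odd row is a parameter Xi because the variable xi^(k-1)
exists only for k - 1 < n. *)
Lemma speval_column_det k (Xi : 'I_l -> A) : anticommuting Xi ->
    (forall (p : 'I_(height k)) j, (k.-1 <= p)%N -> gen K (label k p) j = Xi j) ->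
    (forall j, speval identity_point (Xi j) = Xi j) ->
  exists N, speval identity_point (D k) =
    (\prod_(p < height k | (k.-1 <= p)%N) Xi (widen_ord (le_height k) p)) *+ N.+1.
Proof.
move=> XiA labelE evXi; set P := \prod_(p < _ | _) _.
pose fixes := [pred s : 'S_(height k) |
  [forall p : 'I_(height k), (p < k.-1)%N ==> (s p == p)]].
exists #|fixes|.-1; rewrite prednK; last first.
  by apply/card_gt0P; exists 1%g; apply/forallP => p; rewrite perm1 eqxx implybT.
rewrite rmorph_sum /= -sumr_const [RHS]big_mkcond; apply: eq_bigr => s _.
rewrite rmorphM rmorph_sign rmorph_prod /=.
have evE (p : 'I_(height k)) : speval identity_point
    ((\matrix_(p < height k, c < height k)
      gen K (label k p) (widen_ord (le_height k) c)) p (s p)) =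
  if (k.-1 <= p)%N then Xi (widen_ord (le_height k) (s p)) else (p == s p)%:R.
  rewrite mxE; case: leqP => [kp|pk]; first by rewrite labelE.
  rewrite /row_label pk gen_rshift speval_X /identity_point mxvecE mxE /=.
  by rewrite scaler_nat.
under eq_bigr do rewrite evE.
case: ifPn => [/forallP /= sfix|].
  have -> : \prod_(p < height k) (if (k.-1 <= p)%N then Xi (widen_ord (le_height k) (s p))
      else (p == s p)%:R) =
      \prod_(p < height k | (k.-1 <= p)%N) Xi (widen_ord (le_height k) (s p)).
    rewrite [RHS]big_mkcond; apply: eq_bigr => p _; case: leqP => // pk.
    by have := sfix p; rewrite pk /= => /eqP ->; rewrite eqxx.
  have XiA' : anticommuting (fun p => Xi (widen_ord (le_height k) p)).
    by move=> i j; apply: XiA.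
  rewrite -big_filter (@anticommuting_perm _ _
    (fun p => Xi (widen_ord (le_height k) p))) ?filter_uniq ?index_enum_uniq //.
    by rewrite big_filter mulrA -expr2 sqrr_sign mul1r.
  move=> p; rewrite mem_filter mem_index_enum andbT -ltnNge => pk.
  by have := sfix p; rewrite pk => /eqP.
rewrite negb_forall => /existsP[p]; rewrite negb_imply => /andP[pk nsp].
by rewrite (@prod_eq0 _ _ _ p) ?mulr0 // leqNgt pk eq_sym (negPf nsp).
Qed.

(** Differentiating recovers f from xi^i_j f. *)
Lemma xivar_mul_neq0 (i : 'I_n) j (f : A) :
  dgen (lshift n i) j f = 0 -> f != 0 -> xivar K i j * f != 0.
Proof.
move=> df0; apply: contra => /eqP xf0; have := congr1 (dgen (lshift n i) j) xf0.
rewrite -gen_lshift dgen_superderivation dgen_gen !eqxx df0 mulr0 addr0 mul1r linear0.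
by move->.
Qed.

Lemma xivar_prod_mul_neq0 (i : 'I_n) (L : seq 'I_l) (f : A) : uniq L ->
    (forall j, dgen (lshift n i) j f = 0) -> f != 0 ->
  (\prod_(j <- L) xivar K i j) * f != 0.
Proof.
move=> uL df0 nf; elim: L uL => [|j L IHL] /=; first by rewrite big_nil mul1r.
case/andP=> jL uL; rewrite big_cons -mulrA xivar_mul_neq0 ?IHL //.
have dL := @dgen_superderivation K n l (lshift n i) j.
rewrite dL df0 mulr0 addr0 (superderivation_prod_eq0 dL) ?mul0r // => j' j'L.
rewrite -gen_lshift dgen_gen eqxx /=; case: eqP => // e.
by rewrite e j'L in jL.
Qed.

Lemma speval_column_det_xi k : exists N,
  (exists (i : 'I_n) (L : seq 'I_l), [/\ i = k.-1 :> nat, uniq L &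
     speval identity_point (D k) = (\prod_(j <- L) xivar K i j) *+ N.+1])
  \/ speval identity_point (D k) = 1 *+ N.+1.
Proof.
have [le_nk|lt_kn] := leqP n k.-1.
  have no_row (p : 'I_(height k)) : (k.-1 <= p)%N = false.
    by apply: contraFF (ltnn p) => /(leq_trans le_nk)/(leq_trans le_ln);
      apply: leq_trans; apply: leq_trans (le_height k).
  (* No odd row exists here, so Xi can be taken to be 0. *)
  have [|p j|j|N ->] := @speval_column_det k (fun _ => 0).
  - by move=> i j; rewrite mulr0 oppr0.
  - by rewrite no_row.
  - exact: linear0.
  by exists N; right; rewrite big_pred0.
pose i := Ordinal lt_kn.
have xiA : anticommuting (@xivar K n l i) by move=> j j'; apply: spXi_anticomm.
have [p j kp|j|N ->] := speval_column_det xiA (k := k).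
- by rewrite -gen_lshift; congr gen; apply/eqP; rewrite row_label_lshift eqxx.
- exact: speval_Xi.
exists N; left; exists i, (map (widen_ord (le_height k))
  [seq p : 'I_(height k) <- index_enum 'I_(height k) | (k.-1 <= p)%N]).
split=> //; last by rewrite big_map big_filter.
rewrite map_inj_uniq ?filter_uniq ?index_enum_uniq // => p p'.
by move/(congr1 val) => /= e; apply/val_inj.
Qed.

(** The odd variables of the factor k lie in the row k - 1, so none of them
occurs in the remaining factors. *)
Lemma column_det_prod_neq0 (s : seq nat) :
  uniq s -> 0%N \notin s -> \prod_(k <- s) D k != 0.
Proof.
move=> us s0; suff : speval identity_point (\prod_(k <- s) D k) != 0.
  by apply: contraNneq => ->; rewrite linear0.
rewrite rmorph_prod /=; elim: s us s0 => [|k s IHs] /=.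
  by rewrite big_nil oner_neq0.
case/andP=> ks us; rewrite inE negb_or eq_sym -lt0n => /andP[k_gt0 s0].
rewrite big_cons; have {IHs} := IHs us s0; set w := \prod_(k' <- s) _ => nw.
have [N [[i [L [ei uL ->]]]|->]] := speval_column_det_xi k; last first.
  by rewrite mulrnAl mul1r; apply: contraNneq nw => /superpoly_natmul_eq0 ->.
have : (\prod_(j <- L) xivar K i j) * w != 0; last first.
  by rewrite mulrnAl; apply: contraNneq => /superpoly_natmul_eq0 ->.
apply: xivar_prod_mul_neq0 => // j.
have dj := @dgen_superderivation K n l (lshift n i) j.
apply: (superderivation_prod_eq0 dj) => k' k's.
have k'_gt0 : (0 < k')%N by rewrite lt0n; apply: contraNneq s0 => <-.
have [N' [[i' [L' [ei' _ ->]]]|->]] := speval_column_det_xi k'; last first.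
  by rewrite linearMn /= (superderivation1 dj) mul0rn.
rewrite linearMn /= (superderivation_prod_eq0 dj) ?mul0rn // => j' _.
rewrite -gen_lshift dgen_gen eq_lshift; case: eqP => // eii'.
case/negP: ks; rewrite -(prednK k_gt0) -ei eii' ei' prednK //.
Qed.
End NonVanishing.

(** * The highest weight vector *)

Section HighestWeightProduct.
Variables (K : numDomainType) (n l : nat) (le_ln : (l <= n)%N).
Variables (lam : seq nat) (lam_len : (size lam <= l)%N) (m : nat).
Local Notation A := (superpoly K (n * l) (n * l)).
Let v : A := \prod_(1 <= k < m) column_det K le_ln lam_len k.

Lemma glnn_op_x_xi_prod (i i' : 'I_n) : i' = i.+1 :> nat ->
  glnn_op (rshift n i) (lshift n i') v = 0.
Proof.
move=> ei'; apply: (superderivation_prod_eq0 (@glnn_op_superderivation K n l _ _)).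
by move=> k _; apply: glnn_op_x_xi_column_det.
Qed.

Lemma gll_op_prod (j j' : 'I_l) : (j < j')%N -> gll_op j j' v = 0.
Proof.
move=> jj'; apply: (superderivation_prod_eq0 (@gll_op_derivation K n l j j')).
by move=> k _; apply: gll_op_column_det.
Qed.

Lemma column_det_prod_highest_weight : highest_weight_vector v.
Proof.
pose mult a k := #|[pred p | row_label le_ln (column_length_leq lam_len k) k p == a]|.
apply: (@highest_weight_vectorP _ _ _ _
  (fun a => \sum_(1 <= k < m) mult a k)%N
  (fun j => \sum_(1 <= k < m) (j < column_length lam k))%N).
- by rewrite column_det_prod_neq0 ?iota_uniq // mem_index_iota.
- apply: glnn_op_positive_root; first by move=> i; apply: glnn_op_xi_x_prod.
  exact: glnn_op_x_xi_prod.
- exact: gll_op_prod.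
- move=> a; have dE := @glnn_op_superderivation K n l a a; rewrite addbb in dE.
  apply: (superderivation_prod_eigen dE) => k _; exact: glnn_op_gen_det_diag.
move=> j; apply: (superderivation_prod_eigen (@gll_op_derivation K n l j j)) => k _.
exact: gll_op_gen_det_diag.
Qed.
End HighestWeightProduct.

Local Open Scope complex_scope.

Theorem theorem7p1 (R : realType) (n l : nat)
  (l_ge1 : (1 <= l)%N) (le_ln : (l <= n)%N)
  (lam : seq nat) (lam_part : is_partition lam)
  (lam_len : (size lam <= l)%N) :
  let v : xxi_alg R[i] n l :=
    \prod_(1 <= k < (head 0%N lam).+1)
      \det (upper_left (column_length_leq lam_len k) (Xmx R[i] le_ln k)) in
  [/\ forall i : 'I_n, \sum_(j < l) xivar R[i] i j * dx i j v = 0,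
      forall i i' : 'I_n, i' = i.+1 :> nat ->
        \sum_(j < l) xvar R[i] i j * dxi i' j v = 0,
      forall j j' : 'I_l, j' = j.+1 :> nat ->
        \sum_(i < n) xivar R[i] i j * dxi i j' v +
        \sum_(i < n) xvar R[i] i j * dx i j' v = 0
    & highest_weight_vector v].
Proof.
have -> : \prod_(1 <= k < (head 0%N lam).+1)
      \det (upper_left (column_length_leq lam_len k) (Xmx R[i] le_ln k)) =
    \prod_(1 <= k < (head 0%N lam).+1) column_det R[i] le_ln lam_len k.
  by apply: eq_bigr => k _; apply: column_detE.
move=> v; split=> [i|i i' ei'|j j' ej'|].
- under eq_bigr do rewrite -gen_lshift -dgen_rshift.
  exact: glnn_op_xi_x_prod.
- under eq_bigr do rewrite -gen_rshift -dgen_lshift.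
  exact: glnn_op_x_xi_prod.
- by rewrite -gll_op_split gll_op_prod // ej'.
exact: column_det_prod_highest_weight.
Qed.
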